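(* Let $X_1,\ldots,X_L\subseteq\Omega$ be (not necessarily nested) finite point sets, let $Y_L=X_1\cup\cdots\cup X_L=\{\boldsymbol{y}_1,\ldots,\boldsymbol{y}_{n_L}\}$ with $n_L=|Y_L|$, and let $\mathcal{B}(Y_L)=\{b_i=A_L(X;\boldsymbol{e}_i):1\le i\le n_L\}$. Then the multilevel approximation $A_L(X;f)$ to $f\in C(\Omega)$ is given by $$A_L(X;f)=\sum_{i=1}^{n_L}f(\boldsymbol{y}_i)b_i.$$ Moreover, $\mathcal{B}(Y_L)$ forms a basis of $\widetilde V_L=A_L(X;C(\Omega))$, showing $\dim\widetilde V_L=n_L$.
   Context: Let $\Omega\subseteq\mathbb{R}^d$ be a bounded domain and $X_\ell=\{\boldsymbol{x}_1^{(\ell)},\ldots,\boldsymbol{x}_{N_\ell}^{(\ell)}\}\subseteq\Omega$, $1\le\ell\le L$, finite sets of distinct points. It is not assumed that $X_\ell\subseteq X_{\ell+1}$, nor that the sets are pairwise disjoint. Their fill distances $h_\ell=\sup_{\boldsymbol{x}\in\Omega}\min_{1\le i\le N_\ell}\|\boldsymbol{x}-\boldsymbol{x}_i^{(\ell)}\|_2$ satisfy $c\mu h_\ell\le h_{\ell+1}\le\mu h_\ell$ with fixed $\mu\in(0,1)$, $c\in(0,1]$. Let $\Phi:\mathbb{R}^d\to\mathbb{R}$ be a positive definite radial basis function (continuous, with all matrices $(\Phi(\boldsymbol{z}_i-\boldsymbol{z}_j))_{i,j}$ for distinct points positive definite) with support in the closed unit ball, and let $\Phi_\ell=\delta_\ell^{-d}\Phi(\cdot/\delta_\ell)$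 with $\delta_\ell=\nu h_\ell$ and a fixed $\nu>1$. Let $W_\ell=\operatorname{span}\{\Phi_\ell(\cdot-\boldsymbol{x}_i^{(\ell)}):1\le i\le N_\ell\}$ and $V_L=W_1+\cdots+W_L$. It is a standing fact in this setting that this sum is direct, $V_L=W_1\oplus\cdots\oplus W_L$. For $g\in C(\Omega)$ let $I_{X_\ell,\Phi_\ell}(g)\in W_\ell$ be the unique element of $W_\ell$ that coincides with $g$ on $X_\ell$. For $f\in C(\Omega)$ put $e_0=f$ and, for $\ell\ge1$, $s_\ell=I_{X_\ell,\Phi_\ell}(e_{\ell-1})$, $e_\ell=e_{\ell-1}-s_\ell$; the multilevel operator is $A_L(X;f)=\sum_{\ell=1}^Ls_\ell$. $A_L(X;f)$ depends only on the values $f|_{Y_L}\in\mathbb{R}^{n_L}$; for $\boldsymbol{a}\in\mathbb{R}^{n_L}$ one writes $A_L(X;\boldsymbol{a}):=A_L(X;f)$ for any $f\in C(\Omega)$ with $f|_{Y_L}=\boldsymbol{a}$. $\boldsymbol{e}_i$ is the $i$-th unit vector of $\mathbb{R}^{n_L}$. *)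

(* Defs.v *)
From HB Require Import structures.
From mathcomp Require Import all_boot all_order all_algebra.
From mathcomp Require Import all_classical all_reals all_analysis.

Set Implicit Arguments.
Unset Strict Implicit.
Unset Printing Implicit Defensive.

Import Order.TTheory GRing.Theory Num.Theory.
Import numFieldNormedType.Exports.

Local Open Scope classical_set_scope.
Local Open Scope ring_scope.

(* Linear algebra in a possibly infinite-dimensional space. *)

Definition lin_span (R : realType) (V : lmodType R) n (b : 'I_n -> V) : set V :=
  [set v | exists c : 'I_n -> R, v = \sum_(i < n) c i *: b i].

Definition lin_indep (R : realType) (V : lmodType R) n (b : 'I_n -> V) : Prop :=
  forall c : 'I_n -> R, \sum_(i < n) c i *: b i = 0 -> forall i, c i = 0.

Definition is_basis (R : realType) (V : lmodType R) (S : set V) n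
    (b : 'I_n -> V) : Prop :=
  lin_indep b /\ S = lin_span b.

Definition has_dim (R : realType) (V : lmodType R) (S : set V) (n : nat) : Prop :=
  exists b : 'I_n -> V, is_basis S b.

(* The sum W 1 + ... + W L is direct; W is only looked at on 1, ..., L. *)
Definition direct_sum (R : realType) (V : lmodType R) (W : nat -> set V)
    (L : nat) : Prop :=
  forall w : nat -> V,
    (forall l, (1 <= l <= L)%N -> W l (w l)) ->
    \sum_(1 <= l < L.+1) w l = 0 ->
    forall l, (1 <= l <= L)%N -> w l = 0.

(* The library norm on 'rV[R]_d is the maximum norm; it induces the same
   topology and the same bounded sets as the Euclidean one. *)
Definition enorm (R : realType) d (z : 'rV[R]_d) : R :=
  Num.sqrt (\sum_(i < d) z 0 i ^+ 2).

Definition pos_def_mx (R : realType) n (A : 'M[R]_n) : Prop :=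
  A^T = A /\ forall v : 'rV[R]_n, v != 0 -> 0 < (v *m A *m v^T) 0 0.

Definition pos_def_rbf (R : realType) d (Phi : 'rV[R]_d -> R) : Prop :=
  [/\ continuous Phi,
      exists phi : R -> R, forall z, Phi z = phi (enorm z)
    & forall n (z : 'I_n -> 'rV[R]_d), injective z ->
        pos_def_mx (\matrix_(i < n, j < n) Phi (z i - z j))].

(* A domain: nonempty, open and connected. *)
Definition is_domain (R : realType) d (Omega : set 'rV[R]_d) : Prop :=
  [/\ Omega !=set0, open Omega & connected Omega].

(* Functions on Omega are functions on the subtype of its points, which carries
   the subspace topology. *)
Definition continuous_functions (R : realType) d (Omega : set 'rV[R]_d) :
    set (Omega -> R) :=
  [set f | continuous f].

(* The infimum is a minimum, the family of points being finite; for n = 0 it is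
   the junk value 0. *)
Definition fill_distance (R : realType) d (Omega : set 'rV[R]_d) n
    (x : 'I_n -> Omega) : R :=
  sup [set inf [set enorm (\val u - \val (x i)) | i in [set: 'I_n]]
      | u in [set: Omega]].

Definition rescale (R : realType) d (Phi : 'rV[R]_d -> R) (delta : R)
    (z : 'rV[R]_d) : R :=
  delta ^- d * Phi (delta^-1 *: z).

(* The kernel is scaled by nu times the fill distance of the centres. *)
Definition rbf_space (R : realType) d (Omega : set 'rV[R]_d)
    (Phi : 'rV[R]_d -> R) (nu : R) n (x : 'I_n -> Omega) : set (Omega -> R) :=
  lin_span (fun (i : 'I_n) (u : Omega) =>
    rescale Phi (nu * fill_distance x) (\val u - \val (x i))).

(* The element of W that agrees with g at the points x, whenever there is
   exactly one. *)
Definition interpolant (R : realType) (T : Type) (W : set (T -> R)) n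
    (x : 'I_n -> T) (g : T -> R) : T -> R :=
  xget 0 [set s | W s /\ forall i, s (x i) = g (x i)].

Section Multilevel.
Variables (R : realType) (T : Type).
(* The levels are numbered from 1; level 0 is never used. *)
Variables (W : nat -> set (T -> R)) (N : nat -> nat).
Variable x : forall l, 'I_(N l) -> T.

Fixpoint ml_residual (f : T -> R) (l : nat) : T -> R :=
  if l is k.+1 then
    ml_residual f k - interpolant (W l) (x (l := l)) (ml_residual f k)
  else f.

Definition ml_update (f : T -> R) (l : nat) : T -> R :=
  interpolant (W l) (x (l := l)) (ml_residual f l.-1).

Definition ml_approx (L : nat) (f : T -> R) : T -> R :=
  \sum_(1 <= l < L.+1) ml_update f l.

End Multilevel.

Section MultilevelRBF.
Variables (R : realType) (d : nat) (Omega : set 'rV[R]_d).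
Variables (Phi : 'rV[R]_d -> R) (nu : R) (N : nat -> nat).
Variable x : forall l, 'I_(N l) -> Omega.

Definition rbf_spaces (l : nat) : set (Omega -> R) :=
  rbf_space Phi nu (x (l := l)).

Definition rbf_approx (L : nat) (f : Omega -> R) : Omega -> R :=
  ml_approx rbf_spaces x L f.

(* The operator applied to a vector of data at the points y, through some
   continuous function with these values. *)
Definition rbf_approx_data (L n : nat) (y : 'I_n -> Omega) (a : 'rV[R]_n) :
    Omega -> R :=
  rbf_approx L
    (xget 0 [set f | continuous_functions f /\ forall i, f (y i) = a 0 i]).

End MultilevelRBF.

(* Main.v *)
Require Import Defs.
From HB Require Import structures.
From mathcomp Require Import all_boot all_order all_algebra.
From mathcomp Require Import all_classical all_reals all_analysis.
Import Order.TTheory GRing.Theory Num.Theory.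
Import numFieldNormedType.Exports.
Local Open Scope classical_set_scope.
Local Open Scope ring_scope.


Set Implicit Arguments.
Unset Strict Implicit.
Unset Printing Implicit Defensive.

(** Interpolation at level [l] is possible and unique because the kernel matrix
    of the centres [x l] is positive definite, hence invertible; this needs the
    scaling parameter [nu * fill_distance (x l)] to be positive, which holds
    because a nonempty open set cannot be exhausted by finitely many points
    ([rbf_space_unisolvent], [fill_distance_gt0]). Each level is then a linear
    map, so the multilevel operator [A] is linear ([ml_approx_linear]).

    The kernel of [A] consists exactly of the functions that vanish on all the
    centres ([ml_approx_eq0P]). If [f] vanishes there, every level interpolates
    zero data and no correction is ever made. Conversely, if [A f = 0], then the
    corrections sum to zero, so each of them is zero because the sum of the
    spaces [W l] is direct; the residual is thus [f] at every level, and since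
    its interpolant at level [l] is zero, [f] vanishes on [x l].

    So [A] factors through an injective linear map on the values at the points
    [y], a copy of [R^n]. The functions [b i] are the images of the unit vectors
    under this map, which makes them a basis of the range of [A] and gives the
    expansion of [A f] ([ml_approx_expansion], [ml_approx_basis]). Every vector
    of values is attained by a continuous function: positive definiteness of
    the unscaled kernel at the points [y] provides one
    ([continuous_interpolation]). *)

(** * Interpolation in a space of functions *)

Section Unisolvence.
Variables (R : realType) (T : Type).
Implicit Types (W : set (T -> R)) (f g s t : T -> R) (a : R).

Definition unisolvent W n (x : 'I_n -> T) : Prop :=
  [/\ forall a s t, W s -> W t -> W (a *: s + t),
      forall g, exists s, W s /\ forall i, s (x i) = g (x i)
    & forall s, W s -> (forall i, s (x i) = 0) -> s = 0].

Section Interpolation.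
Variables (W : set (T -> R)) (n : nat) (x : 'I_n -> T).
Hypothesis Wx : unisolvent W x.

Lemma interpolantP g :
  W (interpolant W x g) /\ forall i, interpolant W x g (x i) = g (x i).
Proof. by case: Wx => _ /(_ g) exs _; exact: (xgetPex 0 exs). Qed.

Lemma interpolant_unique g s :
  W s -> (forall i, s (x i) = g (x i)) -> interpolant W x g = s.
Proof.
move=> Ws sg; have [WI Ig] := interpolantP g; case: Wx => Wlin _ Winj.
apply/eqP; rewrite eq_sym -subr_eq0; apply/eqP.
rewrite addrC -scaleN1r; apply: Winj => [|i]; first exact: Wlin.
by rewrite /= !fctE Ig sg scaleN1r addNr.
Qed.

Lemma interpolant_linear a f g :
  interpolant W x (a *: f + g) = a *: interpolant W x f + interpolant W x g.
Proof.
have [WIf If] := interpolantP f; have [WIg Ig] := interpolantP g.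
have [Wlin _ _] := Wx.
by apply: interpolant_unique => [|i]; [exact: Wlin | rewrite /= !fctE If Ig].
Qed.

Lemma interpolant_eq0 g :
  interpolant W x g = 0 <-> forall i, g (x i) = 0.
Proof.
have [WI Ig] := interpolantP g; have [_ _ Winj] := Wx; split=> [I0 i|g0].
  by rewrite -Ig I0.
by apply: Winj => // i; rewrite Ig g0.
Qed.

End Interpolation.

(** Evaluating a combination of kernel translates at the centres multiplies its
    coefficient vector by the kernel matrix, which positive definiteness makes
    invertible: surjectivity yields the interpolant, and injectivity its
    uniqueness. *)
Lemma kernel_unisolvent (K : T -> T -> R) n (x : 'I_n -> T) :
  pos_def_mx (\matrix_(i < n, j < n) K (x i) (x j)) ->
  unisolvent (lin_span (fun (i : 'I_n) u => K u (x i))) x.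
Proof.
set M := \matrix_(i, j) _ => -[/matrixP Msym Mpos].
have Ksym i j : K (x i) (x j) = K (x j) (x i).
  by have := Msym j i; rewrite !mxE.
have evalE (c : 'I_n -> R) j :
    (\sum_(i < n) c i *: (fun u => K u (x i))) (x j) = ((\row_i c i) *m M) 0 j.
  rewrite fct_sumE mxE; apply: eq_bigr => i _.
  by rewrite !mxE Ksym.
have Minj (v : 'rV_n) : v *m M = 0 -> v = 0.
  move=> vM; apply/eqP; apply: contraT => /Mpos.
  by rewrite vM mul0mx mxE ltxx.
split=> [a s t [c ->] [e ->]|g|s [c ->] s0].
- exists (fun i => a * c i + e i); rewrite scaler_sumr -big_split /=.
  by apply: eq_bigr => i _; rewrite scalerDl scalerA.
- have : row_free M.
    rewrite -kermx_eq0; apply/rowV0P => v /sub_kermxP; exact: Minj.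
  rewrite row_free_unit => Munit.
  pose c := (\row_j g (x j)) *m invmx M.
  exists (\sum_(i < n) c 0 i *: (fun u => K u (x i))); split.
    by exists (fun i => c 0 i).
  move=> j; rewrite evalE.
  have -> : \row_i c 0 i = c by apply/rowP => i; rewrite mxE.
  by rewrite mulmxKV // mxE.
- have /rowP c0 : \row_i c i = 0.
    by apply: Minj; apply/rowP => j; rewrite -evalE s0 mxE.
  by rewrite big1 // => i _; have := c0 i; rewrite !mxE => ->; rewrite scale0r.
Qed.

End Unisolvence.

Lemma linear_lincomb (R : realType) (U V : lmodType R) (A : U -> V) :
  linear A -> forall n (c : 'I_n -> R) (f : 'I_n -> U),
  A (\sum_(i < n) c i *: f i) = \sum_(i < n) c i *: A (f i).
Proof.
move=> linA n c f; elim/big_rec2: _ => [|i u v _ <-]; last exact: linA.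
by rewrite -[0 in LHS](addNr 0) -scaleN1r linA scaleN1r addNr.
Qed.

(** * The multilevel operator *)

Section MultilevelOperator.
Variables (R : realType) (T : Type) (W : nat -> set (T -> R)) (N : nat -> nat).
Variables (x : forall l, 'I_(N l) -> T) (L : nat).
Hypothesis Wx : forall l, (1 <= l <= L)%N -> unisolvent (W l) (x (l := l)).
Implicit Types (f g : T -> R).

Lemma ml_residual_linear a f g k : (k <= L)%N ->
  ml_residual W x (a *: f + g) k =
  a *: ml_residual W x f k + ml_residual W x g k.
Proof.
elim: k => // k IH kL.
rewrite /= IH 1?ltnW // interpolant_linear; last exact: Wx.
by rewrite scalerBr opprD addrACA.
Qed.

Lemma ml_approx_linear : linear (ml_approx W x L).
Proof.
move=> a f g; rewrite /ml_approx scaler_sumr -big_split /=.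
rewrite big_nat_cond [RHS]big_nat_cond.
apply: eq_bigr => l /andP[/andP[l1 lL] _].
rewrite /ml_update ml_residual_linear; last exact: leq_trans (leq_pred l) lL.
by rewrite interpolant_linear //; apply: Wx; rewrite l1.
Qed.

Lemma ml_residual_id f :
  (forall l, (1 <= l <= L)%N -> ml_update W x f l = 0) ->
  forall k, (k <= L)%N -> ml_residual W x f k = f.
Proof.
move=> upd0; elim=> //= k IH kL.
by have := upd0 k.+1 kL; rewrite /ml_update /= => ->; rewrite subr0 IH // ltnW.
Qed.

(** With no correction below level [l], the correction at [l] is the interpolant
    of [f] itself, which is zero exactly when [f] vanishes on [x l]. *)
Lemma ml_update_eq0P f :
  (forall l, (1 <= l <= L)%N -> ml_update W x f l = 0) <->
  (forall l, (1 <= l <= L)%N -> forall i : 'I_(N l), f (x i) = 0).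
Proof.
split=> [upd0 l lL|f0].
  apply/(interpolant_eq0 (Wx lL)); rewrite -[RHS](upd0 l lL) /ml_update.
  rewrite ml_residual_id //; case/andP: lL => _; exact: leq_trans (leq_pred l).
have res k : (k <= L)%N -> ml_residual W x f k = f.
  elim: k => //= k IH kL; rewrite IH 1?ltnW //.
  rewrite (_ : interpolant _ _ _ = 0) ?subr0 //.
  by apply/interpolant_eq0; [exact: Wx | exact: f0].
move=> l lL; rewrite /ml_update res.
  by apply/interpolant_eq0; [exact: Wx | exact: f0].
by case/andP: lL => _; exact: leq_trans (leq_pred l).
Qed.

(** Directness of the sum excludes a cancellation between nonzero corrections of
    different levels. *)
Lemma ml_approx_eq0P f : direct_sum W L ->
  ml_approx W x L f = 0 <->
  (forall l, (1 <= l <= L)%N -> forall i : 'I_(N l), f (x i) = 0).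
Proof.
move=> Wdir; rewrite -ml_update_eq0P; split=> [|upd0]; last first.
  by rewrite /ml_approx big_nat big1.
apply: Wdir => l lL.
by have [] := interpolantP (Wx lL) (ml_residual W x f l.-1).
Qed.

Section Basis.
Hypothesis W_direct : direct_sum W L.
Variables (n : nat) (y : 'I_n -> T).
Hypothesis y_range :
  range y = \bigcup_(l in [set l | (1 <= l <= L)%N]) range (x (l := l)).

Lemma ml_approx_eq0 f : ml_approx W x L f = 0 <-> forall j, f (y j) = 0.
Proof.
rewrite ml_approx_eq0P //; split=> [f0 j|f0 l lL i].
  have : range y (y j) by exists j.
  by rewrite y_range => -[l lL [i _ <-]]; exact: f0.
have : range y (x i) by rewrite y_range; exists l => //; exists i.
by move=> [j _ <-].
Qed.

Variables (C : set (T -> R)) (e : 'I_n -> T -> R).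
Hypothesis e_cardinal : forall i j, e i (y j) = (i == j)%:R.

Lemma cardinal_lincomb (c : 'I_n -> R) j :
  (\sum_(i < n) c i *: e i) (y j) = c j.
Proof.
rewrite fct_sumE (bigD1 j) //= big1 => [|i /negPf ij].
  by rewrite addr0 !fctE e_cardinal eqxx /GRing.scale /= mulr1.
by rewrite !fctE e_cardinal ij /GRing.scale /= mulr0.
Qed.

(** [f] and [\sum_i f (y i) *: e i] have the same values on [y], and the operator
    does not see their difference. *)
Lemma ml_approx_expansion f :
  ml_approx W x L f = \sum_(i < n) f (y i) *: ml_approx W x L (e i).
Proof.
rewrite -(linear_lincomb ml_approx_linear).
apply/eqP; rewrite -subr_eq0 addrC -scaleN1r -ml_approx_linear; apply/eqP.
by apply/ml_approx_eq0 => j; rewrite !fctE cardinal_lincomb scaleN1r addNr.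
Qed.

Hypothesis C_lincomb : forall c : 'I_n -> R, C (\sum_(i < n) c i *: e i).

Lemma ml_approx_basis :
  is_basis [set ml_approx W x L f | f in C] (fun i => ml_approx W x L (e i)).
Proof.
split=> [c|].
  rewrite -(linear_lincomb ml_approx_linear) => /ml_approx_eq0 c0 i.
  by rewrite -(c0 i) cardinal_lincomb.
apply/seteqP; split=> [_ [f _ <-]|_ [c ->]].
  by exists (fun i => f (y i)); exact: ml_approx_expansion.
exists (\sum_(i < n) c i *: e i) => //.
exact: (linear_lincomb ml_approx_linear).
Qed.

End Basis.
End MultilevelOperator.

(** * Positivity of the fill distance *)

Section FillDistance.
Variables (R : realType) (d : nat).
Implicit Types z : 'rV[R]_d.

Lemma enorm_ge0 z : 0 <= enorm z.
Proof. exact: sqrtr_ge0. Qed.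

Lemma enorm_gt0 z : z != 0 -> 0 < enorm z.
Proof.
move=> z0; rewrite lt_neqAle enorm_ge0 andbT eq_sym; apply: contraNneq z0.
move=> /eqP; rewrite sqrtr_eq0 => s0; apply/eqP/rowP => i; rewrite mxE.
apply/eqP; rewrite -sqrf_eq0 eq_le sqr_ge0 andbT (le_trans _ s0) //.
by rewrite (bigD1 i) //= lerDl sumr_ge0 // => j _; exact: sqr_ge0.
Qed.

(** Transfers boundedness from the maximum norm to the Euclidean norm. *)
Lemma enorm_le_norm z (M : R) : `|z| <= M -> enorm z <= Num.sqrt (M ^+ 2 *+ d).
Proof.
move=> zM; apply: ler_wsqrtr.
have -> : M ^+ 2 *+ d = \sum_(i < d) M ^+ 2 by rewrite sumr_const card_ord.
apply: ler_sum => i _; rewrite -real_normK ?num_real // lerXn2r ?nnegrE //.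
  exact: le_trans zM.
apply: le_trans zM; rewrite /Num.norm /= mx_normrE.
exact: (le_bigmax _ (fun ij : 'I_1 * 'I_d => `|z ij.1 ij.2|) (0, i)).
Qed.

Variable Omega : set 'rV[R]_d.

(** A ball contains [n.+1] distinct points on one line, too many to be covered by
    [n] points. The dimension has to be positive: [R^0] is open and is a single
    point. *)
Lemma open_avoids_finite n (x : 'I_n -> Omega) :
  (0 < d)%N -> open Omega -> Omega !=set0 ->
  exists u : Omega, forall i, u != x i.
Proof.
move=> d0 Oo [u0 Ou0].
have /nbhs_ballP[r /= r0 rO] : nbhs u0 Omega by exact: open_nbhs_nbhs.
(* The shift k.+2 keeps the step below r, so that every point is in the ball. *)
pose p (k : 'I_n.+1) : 'rV[R]_d := u0 + const_mx (r / k.+2%:R).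
have pO k : Omega (p k).
  apply: rO; rewrite -ball_normE /= opprD addrA subrr add0r normrN.
  rewrite /Num.norm /= mx_normrE.
  apply: bigmax_lt => // ij _; rewrite mxE gtr0_norm ?divr_gt0 //.
  by rewrite ltr_pdivrMr // ltr_pMr // ltr1n.
have p_inj : injective p.
  move=> k m /addrI /rowP /(_ (Ordinal d0)); rewrite !mxE.
  move=> /(mulfI (lt0r_neq0 r0)) /invr_inj /eqP; rewrite eqr_nat.
  by move=> /eqP [km]; exact: val_inj.
apply: contrapT => /forallNP hit.
have /choice[h hP] (k : 'I_n.+1) : exists i, val (x i) = p k.
  have /existsNP[i /negP/negPn/eqP xi] := hit (SigSub (mem_set (pO k))).
  by exists i; rewrite -xi.
have : injective h by move=> k m hkm; apply: p_inj; rewrite -!hP hkm.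
by move=> /leq_card; rewrite !card_ord ltnn.
Qed.

(** A point of [Omega] that is not a centre has positive distance to the centres.
    Boundedness of [Omega] is what makes the supremum at least that distance, a
    supremum of an unbounded set being a junk value. *)
Lemma fill_distance_gt0 n (x : 'I_n -> Omega) :
  (0 < d)%N -> (0 < n)%N -> open Omega -> Omega !=set0 -> bounded_set Omega ->
  0 < fill_distance x.
Proof.
move=> d0 n0 Oo O0 Ob; have [u ux] := open_avoids_finite x d0 Oo O0.
pose i0 := Ordinal n0.
pose D (v : Omega) := [set enorm (\val v - \val (x i)) | i in [set: 'I_n]].
have D0 v : D v !=set0 by exists (enorm (\val v - \val (x i0))), i0.
have Dlb v : lbound (D v) 0 by move=> _ [i _ <-]; exact: enorm_ge0.
have dist0 : 0 < inf (D u).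
  pose dist i := enorm (\val u - \val (x i)).
  case: (@arg_minP _ _ _ i0 xpredT dist) => // i _ imin.
  apply: (@lt_le_trans _ _ (enorm (\val u - \val (x i)))).
    by apply: enorm_gt0; rewrite subr_eq0 (inj_eq val_inj).
  by apply: lb_le_inf => // _ [j _ <-]; exact: imin.
apply: lt_le_trans dist0 _; apply: ub_le_sup; last by exists u.
have [M _ OM] := pinfty_ex_gt0 Ob.
exists (Num.sqrt ((M + M) ^+ 2 *+ d)) => _ [v _ <-].
apply: (@le_trans _ _ (enorm (\val v - \val (x i0)))).
  by apply: (ge_inf (E := D v)); [exists 0; exact: Dlb | exists i0].
apply: enorm_le_norm; apply: (le_trans (ler_normB _ _)).
by apply: lerD; apply: OM; exact: set_valP.
Qed.

End FillDistance.

(** * Radial basis functions *)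

Section RadialBasis.
Variables (R : realType) (d : nat) (Omega : set 'rV[R]_d) (Phi : 'rV[R]_d -> R).
Hypothesis Phi_rbf : pos_def_rbf Phi.

Lemma rescale_pos_def n (z : 'I_n -> 'rV[R]_d) (delta : R) :
  0 < delta -> injective z ->
  pos_def_mx (\matrix_(i < n, j < n) rescale Phi delta (z i - z j)).
Proof.
move=> delta0 z_inj; case: Phi_rbf => _ _ /(_ n (fun i => delta^-1 *: z i)).
set M := \matrix_(i, j) _; set M' := \matrix_(i, j) _ => MP.
have -> : M' = delta ^- d *: M.
  by apply/matrixP => i j; rewrite !mxE /rescale scalerBr.
have [i j|Msym Mpos] := MP.
  by move=> /(scalerI _) /z_inj; apply; rewrite invr_neq0 ?gt_eqF.
split=> [|v v0]; first by rewrite linearZ /= Msym.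
by rewrite -scalemxAr -scalemxAl mxE mulr_gt0 ?Mpos // invr_gt0 exprn_gt0.
Qed.

Lemma rbf_space_unisolvent (nu : R) n (x : 'I_n -> Omega) :
  0 < nu * fill_distance x -> injective x -> unisolvent (rbf_space Phi nu x) x.
Proof.
move=> delta0 x_inj.
apply: (kernel_unisolvent (K := fun u v =>
  rescale Phi (nu * fill_distance x) (\val u - \val v))).
apply: (rescale_pos_def (z := fun i => \val (x i))) => //.
by move=> i j /val_inj /x_inj.
Qed.

Lemma continuous_lincomb n (c : 'I_n -> R) (f : 'I_n -> Omega -> R) :
  (forall i, continuous_functions (f i)) ->
  continuous_functions (\sum_(i < n) c i *: f i).
Proof.
move=> fC; rewrite /continuous_functions /= fct_sumE.
apply: continuous_big => [|i _]; first exact: add_continuous.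
move=> u; apply: (@continuousM _ _ (fun=> c i) (f i)).
  exact: cst_continuous.
exact: fC.
Qed.

(** The translates of [Phi] centred at the points are continuous and, by positive
    definiteness, already interpolate arbitrary data. *)
Lemma continuous_interpolation n (y : 'I_n -> Omega) (a : 'I_n -> R) :
  injective y ->
  exists f : Omega -> R, continuous_functions f /\ forall i, f (y i) = a i.
Proof.
move=> y_inj; have [Phi_cont _ Phi_pos] := Phi_rbf.
pose K (u v : Omega) := Phi (\val u - \val v).
have [|_ ex _] := @kernel_unisolvent _ _ K n y.
  by apply: (Phi_pos n (fun i => \val (y i))) => i j /val_inj /y_inj.
have [g gE] : exists g : Omega -> R, forall i, g (y i) = a i.
  exists (fun u => if [pick i | y i == u] is Some i then a i else 0) => i.
  by case: pickP => [j /eqP/y_inj -> //|/(_ i)]; rewrite eqxx.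
have [_ [[c ->] sE]] := ex g.
exists (\sum_(i < n) c i *: (fun u => K u (y i))).
split=> [|i]; last by rewrite sE gE.
apply: continuous_lincomb => i u.
apply: (@continuous_comp _ _ _ (fun u : Omega => \val u - \val (y i)) Phi);
  last exact: Phi_cont.
have val_cont : continuous (fun u : Omega => \val u).
  exact: initial_continuous.
by apply: (continuousB (val_cont u)); exact: cst_continuous.
Qed.

End RadialBasis.

Unset Implicit Arguments.

Theorem theorem4p1 (R : realType) (d : nat) (hd : (0 < d)%N)
    (Omega : set 'rV[R]_d)
    (Omega_domain : is_domain Omega) (Omega_bounded : bounded_set Omega)
    (Phi : 'rV[R]_d -> R) (Phi_rbf : pos_def_rbf Phi)
    (Phi_supp : closure [set z | Phi z != 0] `<=` [set z | enorm z <= 1])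
    (mu c nu : R) (hmu : 0 < mu < 1) (hc : 0 < c <= 1) (hnu : 1 < nu)
    (L : nat) (hL : (0 < L)%N)
    (N : nat -> nat) (hN : forall l, (1 <= l <= L)%N -> (0 < N l)%N)
    (x : forall l, 'I_(N l) -> Omega)
    (x_inj : forall l, (1 <= l <= L)%N -> injective (x l))
    (x_fill : forall l, (1 <= l < L)%N ->
       c * mu * fill_distance (x l) <= fill_distance (x l.+1)
         <= mu * fill_distance (x l))
    (W_direct : direct_sum (rbf_spaces Phi nu x) L)
    (n : nat) (y : 'I_n -> Omega) (y_inj : injective y)
    (y_range : range y =
       \bigcup_(l in [set l | (1 <= l <= L)%N]) range (x l)) :
  let A := rbf_approx Phi nu x L in
  let b (i : 'I_n) := rbf_approx_data Phi nu x L y (delta_mx 0 i) in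
  let Vtilde := [set A f | f in @continuous_functions R d Omega] in
  [/\ forall f, continuous_functions f -> A f = \sum_(i < n) f (y i) *: b i,
      is_basis Vtilde b
    & has_dim Vtilde n].
Proof.
move=> A b Vtilde; have [domain_neq0 domain_open _] := Omega_domain.
have Wx l : (1 <= l <= L)%N -> unisolvent (rbf_spaces Phi nu x l) (x l).
  move=> lL; apply: rbf_space_unisolvent => //; last exact: x_inj.
  apply: mulr_gt0; first exact: lt_trans hnu.
  by apply: fill_distance_gt0 => //; exact: hN.
pose e (i : 'I_n) : Omega -> R :=
  xget 0 [set f | continuous_functions f
                  /\ forall j, f (y j) = (delta_mx 0 i : 'rV[R]_n) 0 j].
have eP i : continuous_functions (e i)
    /\ forall j, e i (y j) = (delta_mx 0 i : 'rV[R]_n) 0 j.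
  exact: (xgetPex 0 (continuous_interpolation Phi_rbf _ y_inj)).
have e_cardinal i j : e i (y j) = (i == j)%:R.
  by rewrite (eP i).2 mxE eqxx eq_sym.
have basis : is_basis Vtilde b.
  apply: (ml_approx_basis Wx W_direct y_range e_cardinal) => a.
  by apply: continuous_lincomb => i; case: (eP i).
split=> [f _||]; [|exact: basis|by exists b].
exact: (ml_approx_expansion Wx W_direct y_range e_cardinal).
Qed.
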